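(* Let $d\ge1$, $0<\mu\le L<\infty$, $f\in\mathcal{F}_{\mu,L}(\mathbb{R}^d)$, $h\in\mathcal{F}_{0,\infty}(\mathbb{R}^d)$, $F=f+h$, $F_\star=\min_{x\in\mathbb{R}^d}F(x)$, and $x_0\in\mathbb{R}^d$. Let $(x_k)$ be iterates of the proximal gradient method with exact line search started at $x_0$, i.e. for each $k$, $$\gamma_k\in\operatorname{argmin}_{\gamma\in\mathbb{R}}F\big(\mathbf{p}_{\gamma h}(x_k-\gamma\nabla f(x_k))\big),\qquad x_{k+1}=\mathbf{p}_{\gamma_k h}(x_k-\gamma_k\nabla f(x_k)).$$ Then for every $k\geq 0$, $$F(x_{k+1})-F_\star\le\left(\frac{L-\mu}{L+\mu}\right)^2\big(F(x_k)-F_\star\big).$$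
   Context: $\|\cdot\|$ is the Euclidean norm on $\mathbb{R}^d$. $\mathcal{F}_{0,\infty}(\mathbb{R}^d)$ is the class of closed proper convex functions $h:\mathbb{R}^d\to\mathbb{R}\cup\{\infty\}$. $\mathcal{F}_{\mu,L}(\mathbb{R}^d)$ is the class of functions $f:\mathbb{R}^d\to\mathbb{R}$ that are differentiable on all of $\mathbb{R}^d$, $L$-smooth ($\|\nabla f(x+\Delta x)-\nabla f(x)\|\le L\|\Delta x\|$ for all $x,\Delta x\in\mathbb{R}^d$) and $\mu$-strongly convex ($x\mapsto f(x)-\frac{\mu}{2}\|x\|^2$ is convex on $\mathbb{R}^d$). The proximal operator is $\mathbf{p}_{\gamma h}(x)=\operatorname{argmin}_{y\in\mathbb{R}^d}\{\gamma h(y)+\frac12\|x-y\|^2\}$, with the convention $\mathbf{p}_{0h}(x)=x$. In the line search, $\gamma$ ranges over all real values for which this proximal point exists and is unique (in particular all $\gamma\ge 0$), and a minimizer $\gamma_k$ is assumed to exist at each iteration. When $F(x_k)=\infty$ the right-hand side is interpreted with $0\cdot\infty=0$. *)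

(* Defs.v *)
From HB Require Import structures.
From mathcomp Require Import all_boot all_order all_algebra.
From mathcomp Require Import all_classical all_reals all_analysis.

Set Implicit Arguments.
Unset Strict Implicit.
Unset Printing Implicit Defensive.

Import Order.TTheory GRing.Theory Num.Theory.
Import numFieldNormedType.Exports.

Local Open Scope classical_set_scope.
Local Open Scope ring_scope.

(* The library norm `|x| on 'rV[R]_d is the sup norm: it is only used through
   the topology, in [differentiable] and [closed]. *)
Definition enorm (R : realType) (d : nat) (x : 'rV[R]_d) : R :=
  Num.sqrt (\sum_i x 0 i ^+ 2).

Definition grad (R : realType) (d : nat) (f : 'rV[R]_d -> R) (x : 'rV[R]_d) :
  'rV[R]_d := \row_i 'D_(delta_mx 0 i) f x.

Definition L_smooth (R : realType) (d : nat) (L : R) (f : 'rV[R]_d -> R) :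
  Prop :=
  forall x dx, enorm (grad f (x + dx) - grad f x) <= L * enorm dx.

Definition strongly_convex (R : realType) (d : nat) (mu : R)
    (f : 'rV[R]_d -> R) : Prop :=
  convex_function setT (fun x : 'rV[R]_d => f x - mu / 2 * enorm x ^+ 2).

Definition smooth_strongly_convex (R : realType) (d : nat) (mu L : R)
    (f : 'rV[R]_d -> R) : Prop :=
  [/\ forall x, differentiable f x, L_smooth L f & strongly_convex mu f].

Definition epigraph (R : realType) (d : nat) (h : 'rV[R]_d -> \bar R) :
  set ('rV[R]_d * R^o) := [set z | (h z.1 <= z.2%:E)%E].

Definition closed_proper_convex (R : realType) (d : nat)
    (h : 'rV[R]_d -> \bar R) : Prop :=
  [/\ closed (epigraph h),
      (forall x, h x != -oo%E) /\ (exists x, h x != +oo%E)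
    & convex_set (epigraph h)].

Definition argmin (R : realType) (T : Type) (D : set T) (phi : T -> \bar R) :
  set T := [set x | D x /\ forall y, D y -> (phi x <= phi y)%E].

(* The value of phi at a minimizer over R^d; meaningful only when phi attains
   its minimum. *)
Definition min_value (R : realType) (d : nat) (phi : 'rV[R]_d -> \bar R) :
  \bar R := phi (xget 0 (argmin setT phi)).

(* gamma * h(y) is a product in \bar R: it is 0 when gamma = 0 (even if
   h y = +oo), and -oo when gamma < 0 and h y = +oo. *)
Definition prox_set (R : realType) (d : nat) (gamma : R)
    (h : 'rV[R]_d -> \bar R) (x : 'rV[R]_d) : set 'rV[R]_d :=
  argmin setT
    (fun y => gamma%:E * h y + (2^-1 * enorm (x - y) ^+ 2)%:E)%E.

Definition prox_defined (R : realType) (d : nat) (gamma : R)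
    (h : 'rV[R]_d -> \bar R) (x : 'rV[R]_d) : Prop :=
  exists p, prox_set gamma h x = [set p].

(* Meaningful only when [prox_defined gamma h x]. *)
Definition prox (R : realType) (d : nat) (gamma : R)
    (h : 'rV[R]_d -> \bar R) (x : 'rV[R]_d) : 'rV[R]_d :=
  xget 0 (prox_set gamma h x).

Definition grad_step (R : realType) (d : nat) (f : 'rV[R]_d -> R)
    (x : 'rV[R]_d) (gamma : R) : 'rV[R]_d := x - gamma *: grad f x.

Definition objective (R : realType) (d : nat) (f : 'rV[R]_d -> R)
    (h : 'rV[R]_d -> \bar R) (x : 'rV[R]_d) : \bar R := ((f x)%:E + h x)%E.

Definition pgm_exact_line_search (R : realType) (d : nat) (f : 'rV[R]_d -> R)
    (h : 'rV[R]_d -> \bar R) (x0 : 'rV[R]_d) (gamma : nat -> R)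
    (x : nat -> 'rV[R]_d) : Prop :=
  x 0%N = x0 /\
  forall k,
    argmin [set g : R | prox_defined g h (grad_step f (x k) g)]
           (fun g => objective f h (prox g h (grad_step f (x k) g)))
           (gamma k) /\
    x k.+1 = prox (gamma k) h (grad_step f (x k) (gamma k)).

Lemma min_valueE (R : realType) (d : nat) (phi : 'rV[R]_d -> \bar R)
  (x : 'rV[R]_d) : argmin setT phi x -> min_value phi = phi x.
Proof.
move=> mx; rewrite /min_value; case: xgetP => [y _ [_ my]|/(_ x)] //.
by apply/le_anti; rewrite my//= (proj2 mx).
Qed.

Lemma enorm_eq0 (R : realType) (d : nat) (x : 'rV[R]_d) : enorm x = 0 -> x = 0.
Proof.
move=> /eqP; rewrite sqrtr_eq0 => sx.
have /eqP := le_anti (introT andP (conj sx (sumr_ge0 _ (fun i _ => sqr_ge0 (x 0 i))))).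
rewrite psumr_eq0 => [/allP x0|i _]; last exact: sqr_ge0.
apply/rowP => i; rewrite mxE; apply/eqP.
by have := x0 i (mem_index_enum _); rewrite sqrf_eq0.
Qed.

Lemma prox_set0 (R : realType) (d : nat) (h : 'rV[R]_d -> \bar R)
  (x : 'rV[R]_d) : prox_set 0 h x = [set x].
Proof.
have e0 : enorm (x - x) = 0.
  rewrite /enorm subrr big1 ?sqrtr0// => i _.
  by rewrite mxE expr0n.
apply/seteqP; split=> [p [_ /(_ x I)]|p ->] /=.
- rewrite !mul0e !add0e lee_fin e0 expr0n mulr0 pmulr_rle0 ?invr_gt0//.
  rewrite real_exprn_even_le0 ?num_real//= => /eqP/enorm_eq0/eqP.
  by rewrite subr_eq0 => /eqP.
- split=> // y _; rewrite !mul0e !add0e lee_fin e0 expr0n mulr0.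
  by rewrite mulr_ge0 ?invr_ge0 ?sqr_ge0.
Qed.

Lemma prox0 (R : realType) (d : nat) (h : 'rV[R]_d -> \bar R)
  (x : 'rV[R]_d) : prox 0 h x = x.
Proof. by rewrite /prox prox_set0; case: xgetP => // /(_ x); case. Qed.

(* Main.v *)
(** Exact line search does at least as well as the fixed step
    [gamma = 2 / (L + mu)], so it suffices to bound one such step
    [x |-> p = prox_(gamma h)(x - gamma f'(x))], against an arbitrary
    comparison point [y].  Let [rho = (L - mu) / (L + mu)].  Add
    - the interpolation inequality of smooth strongly convex functions between
      [(x, p)], [(y, x)] and [(y, p)] with weights [rho], [rho (1 - rho)] and
      [1 - rho];
    - the subgradient inequality of [h] at [p] towards [x] and [y] with
      weights [rho ^ 2] and [1 - rho ^ 2].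
    The function values combine to the claim, and the remaining quadratic form
    is a sum of two squares.  The prox is well defined because a closed convex
    [h] is bounded below on a ball, hence decreases at most linearly, which the
    quadratic term dominates. *)
Require Import Defs.
From mathcomp Require Import all_boot all_order all_algebra.
From mathcomp Require Import all_classical all_reals all_analysis.
From mathcomp Require Import ring lra.

Import Order.TTheory GRing.Theory Num.Theory.
Import numFieldNormedType.Exports.

Local Open Scope classical_set_scope.
Local Open Scope ring_scope.

(** * The Euclidean inner product *)

Definition dot {R : realType} {d : nat} (u v : 'rV[R]_d) : R :=
  \sum_i u 0 i * v 0 i.

Lemma dotxx_ge0 {R : realType} {d : nat} (u : 'rV[R]_d) : 0 <= dot u u.
Proof. by apply: sumr_ge0 => i _; rewrite -expr2 sqr_ge0. Qed.

Lemma sqr_enorm {R : realType} {d : nat} (u : 'rV[R]_d) :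
  enorm u ^+ 2 = dot u u.
Proof.
rewrite /enorm sqr_sqrtr; first by apply: eq_bigr => i _; rewrite expr2.
by apply: sumr_ge0 => i _; rewrite sqr_ge0.
Qed.

Lemma dotxx_eq0 {R : realType} {d : nat} (u : 'rV[R]_d) :
  dot u u <= 0 -> u = 0.
Proof.
move=> u0; apply: enorm_eq0; apply/eqP; rewrite -sqrf_eq0 sqr_enorm.
by rewrite eq_le u0 dotxx_ge0.
Qed.

Lemma dotC {R : realType} {d : nat} (u v : 'rV[R]_d) : dot u v = dot v u.
Proof. by apply: eq_bigr => i _; rewrite mulrC. Qed.

Lemma dotDl {R : realType} {d : nat} (u v w : 'rV[R]_d) :
  dot (u + v) w = dot u w + dot v w.
Proof. by rewrite /dot -big_split; apply: eq_bigr => i _; rewrite mxE mulrDl. Qed.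

Lemma dotZl {R : realType} {d : nat} (a : R) (u v : 'rV[R]_d) :
  dot (a *: u) v = a * dot u v.
Proof. by rewrite /dot mulr_sumr; apply: eq_bigr => i _; rewrite mxE mulrA. Qed.

Lemma dotNl {R : realType} {d : nat} (u v : 'rV[R]_d) :
  dot (- u) v = - dot u v.
Proof. by rewrite -scaleN1r dotZl mulN1r. Qed.

Lemma dotDr {R : realType} {d : nat} (u v w : 'rV[R]_d) :
  dot w (u + v) = dot w u + dot w v.
Proof. by rewrite dotC dotDl !(dotC w). Qed.

Lemma dotZr {R : realType} {d : nat} (a : R) (u v : 'rV[R]_d) :
  dot v (a *: u) = a * dot v u.
Proof. by rewrite dotC dotZl dotC. Qed.

Lemma dotNr {R : realType} {d : nat} (u v : 'rV[R]_d) :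
  dot v (- u) = - dot v u.
Proof. by rewrite dotC dotNl dotC. Qed.

Definition dotE := (@dotDl, @dotDr, @dotNl, @dotNr, @dotZl, @dotZr).

(** * Gradients, and quadratic bounds for smooth strongly convex functions *)

Lemma derive_grad {R : realType} {d : nat} (f : 'rV[R]_d -> R)
    (x w : 'rV[R]_d) :
  differentiable f x -> 'D_w f x = dot (grad f x) w.
Proof.
move=> df; rewrite deriveE// [in LHS](row_sum_delta w) linear_sum.
by apply: eq_bigr => i _; rewrite linearZ mxE deriveE// mulrC.
Qed.

Lemma is_derive_line {R : realType} {d : nat} (f : 'rV[R]_d -> R)
    (x w : 'rV[R]_d) (t : R) :
  differentiable f (x + t *: w) ->
  is_derive t 1 (fun s : R => f (x + s *: w)) (dot (grad f (x + t *: w)) w).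
Proof.
move=> df; rewrite -derive_grad//.
have := derivableP (@diff_derivable _ _ _ f _ w df).
(* The two difference quotients coincide, so derivability and the derivative carry over. *)
have E : (fun h : R => h^-1 *: (f (h *: w + (x + t *: w)) - f (x + t *: w)))
     = (fun h : R => h^-1 *: ((fun s : R => f (x + s *: w)) (h *: 1 + t) -
                     (fun s : R => f (x + s *: w)) t)).
  apply/funext => h /=; rewrite [h%:A]mulr1 scalerDl.
  by rewrite [x + (_ + _)]addrCA.
by case=> c e; split; rewrite /derivable /derive -E.
Qed.

(** Along the ray from [x], [f] minus its quadratic upper model has nonpositive derivative, because
    the gradient is Lipschitz. *)
Lemma L_smooth_upper {R : realType} {d : nat} (L : R) (f : 'rV[R]_d -> R)
    (x w : 'rV[R]_d) :
  0 < L -> (forall x, differentiable f x) -> L_smooth L f ->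
  f (x + w) <= f x + dot (grad f x) w + L / 2 * dot w w.
Proof.
move=> L0 df sf.
have smooth t : 0 < t ->
    dot (grad f (x + t *: w) - grad f x) w <= L * t * dot w w.
  move=> t0; have := sf x (t *: w).
  move: (grad f (x + t *: w) - grad f x) => v vw'.
  have vw : dot v v <= (L * t) ^+ 2 * dot w w.
    move: vw'; rewrite -(@ler_pXn2r _ 2)//; last 2 first.
    - by rewrite nnegrE sqrtr_ge0.
    - by rewrite nnegrE mulr_ge0 ?sqrtr_ge0 ?(ltW L0).
    by rewrite exprMn !sqr_enorm dotZl dotZr; lra.
  have Lt : 0 < L * t by rewrite mulr_gt0.
  (* Cauchy-Schwarz in disguise: expanding this square turns the bound on [dot v v] into one on
     [dot v w]. *)
  have := dotxx_ge0 (v - (L * t) *: w).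
  rewrite !dotE (dotC w v) => h.
  rewrite -(ler_pM2l Lt); nra.
pose psi (t : R) : R :=
  f (x + t *: w) - t * dot (grad f x) w - L / 2 * dot w w * t ^+ 2.
have dpsi t : is_derive (t : R) 1 psi (dot (grad f (x + t *: w) - grad f x) w
                       - L * t * dot w w).
  have := is_derive_line f x w t (df _) => dd.
  rewrite /psi; apply: is_derive_eq.
  rewrite /GRing.scale /= dotDl dotNl; by field.
have : psi 1 <= psi 0.
  apply: (@ler0_derive1_nincry _ psi 0) => //.
  - move=> t; rewrite in_itv/= andbT => t0.
    by rewrite derive1E derive_val subr_le0 smooth.
  - apply: continuous_subspaceT => t; apply: differentiable_continuous.
    by apply/derivable1_diffP.
rewrite /psi scale1r scale0r addr0; lra.
Qed.

Lemma conv_lmodE {R : realType} {V : lmodType R} (p : {i01 R}) (u v : V) :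
  conv p (u : convex_lmodType V) v = p%:num *: u + (1 - p%:num) *: v.
Proof. by []. Qed.

Lemma conv_realE {R : realType} (p : {i01 R}) (a b : R^o) :
  conv p a b = p%:num * a + (1 - p%:num) * b :> R.
Proof. by []. Qed.

(** Convexity of [f - mu / 2 |.|^2] between [x] and [x + w] bounds the difference quotient for [t]
    in (0, 1); then [t] tends to 0 from the right. *)
Lemma strongly_convex_lower {R : realType} {d : nat} (mu : R)
    (f : 'rV[R]_d -> R) (x w : 'rV[R]_d) :
  differentiable f x -> strongly_convex mu f ->
  f x + dot (grad f x) w + mu / 2 * dot w w <= f (x + w).
Proof.
move=> df cf.
have cvx (t : R) : 0 < t -> t < 1 ->
    t^-1 * (f (t *: w + x) - f x) + mu / 2 * (1 - t) * dot w w
    <= f (x + w) - f x.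
  move=> t0 t1.
  have := cf (Itv01 (ltW t0) (ltW t1)) (x + w) x (mem_set I) (mem_set I).
  rewrite conv_lmodE conv_realE /=.
  have -> : t *: (x + w) + (1 - t) *: x = t *: w + x.
    by apply/rowP => i; rewrite !mxE; ring.
  rewrite !sqr_enorm !dotE (dotC x w) => le_cvx.
  rewrite -(ler_pM2l t0) mulrDr mulVKf ?gt_eqF//.
  lra.
have cvg_quot : (fun t : R => t^-1 * (f (t *: w + x) - f x)
      + mu / 2 * (1 - t) * dot w w)
    @ 0^'+ --> dot (grad f x) w + mu / 2 * (1 - 0) * dot w w.
  apply: cvgD.
    rewrite -derive_grad//; apply: cvg_dnbhs_at_right.
    exact: (@diff_derivable _ _ _ f _ w df).
  apply: cvg_at_right_filter; apply: cvgMr_tmp; apply: cvgMl_tmp.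
  by apply: cvgB; [exact: cvg_cst|exact: cvg_id].
suff : dot (grad f x) w + mu / 2 * (1 - 0) * dot w w <= f (x + w) - f x by lra.
apply: (cvgr_to_le cvg_quot).
near=> t; apply: cvx; near: t.
  exact: nbhs_right_gt.
exact: nbhs_right_lt.
Unshelve. all: end_near. Qed.

(* The lower bound at [y] and the upper bound at [x] are compared at the point
   [x - r / (L - mu)], which minimizes their difference. *)
Lemma smooth_strongly_convex_interpolation {R : realType} {d : nat} (mu L : R)
    (f : 'rV[R]_d -> R) (x y : 'rV[R]_d)
    (r := grad f x - grad f y - mu *: (x - y)) :
  0 < mu -> mu < L -> smooth_strongly_convex mu L f ->
  f y + dot (grad f y) (x - y) + mu / 2 * dot (x - y) (x - y)
    + (2 * (L - mu))^-1 * dot r r <= f x.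
Proof.
move=> mu0 muL [df sf cf].
have L0 : 0 < L := lt_trans mu0 muL.
have l0 : 0 < L - mu by rewrite subr_gt0.
have c2 : (L - mu)^-1 ^+ 2 * (L - mu) = (L - mu)^-1 by field; rewrite gt_eqF.
rewrite invfM; move: c2; set c := (L - mu)^-1 => c2.
have := L_smooth_upper L f x (- (c *: r)) L0 df sf.
have := strongly_convex_lower mu f y (x - y - c *: r) (df y) cf.
have -> : y + (x - y - c *: r) = x - c *: r by rewrite addrA addrCA subrr addr0.
have -> : grad f x = grad f y + mu *: (x - y) + r.
  by apply/rowP => i; rewrite !mxE; ring.
move: (x - y) (grad f y) r => e g r.
rewrite !dotE (dotC r e) => lower upper.
have : c ^+ 2 * (L - mu) * dot r r = c * dot r r by rewrite c2.
lra.
Qed.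

(** * Compactness, lower semicontinuity and epigraphs *)

(** The sublevel sets at levels above the infimum generate a filter on [K]; being closed, they all
    contain any cluster point of it. *)
Lemma compact_lsc_min {R : realType} {T : topologicalType} (K : set T)
    (phi : T -> \bar R) :
  compact K -> K !=set0 -> (forall a : R, closed [set y | (phi y <= a%:E)%E]) ->
  exists2 p, K p & forall y, K y -> (phi p <= phi y)%E.
Proof.
move=> cK [k0 Kk0] clphi.
pose m := ereal_inf (phi @` K).
have mlb y : K y -> (m <= phi y)%E.
  by move=> Ky; apply: ereal_inf_lbound; exists y.
have [mfin|/negP] := pselect (m < +oo)%E; last first.
  (* If the infimum is [+oo], so is every value on [K]. *)
  rewrite -leNgt leye_eq => /eqP mE; exists k0 => // y Ky.
  by rewrite [leRHS](_ : _ = +oo%E) ?leey//; apply/eqP; rewrite -leye_eq -mE mlb.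
pose D := [set a : R | (m < a%:E)%E].
pose S (a : R) := K `&` [set y | (phi y <= a%:E)%E].
have [b Db] : exists b : R, D b.
  case: m mfin @D {mlb} => [r| |] // _ D.
    by exists (r + 1); rewrite /D /= lte_fin ltrDl.
  by exists 0; rewrite /D /= ltNyr.
have FF : ProperFilter (filter_from D S).
  apply: filter_from_proper.
    apply: filter_from_filter; first by exists b.
    move=> i j Di Dj; exists (Num.min i j).
      by rewrite /D /= EFin_min lt_min Di.
    move=> y [Ky]; rewrite /= EFin_min le_min => /andP[yi yj].
    by split; split.
  move=> a Da; have [_ [y Ky <-] ya] := ereal_inf_lt Da.
  by exists y; split => //; apply/ltW.
have [p [Kp clp]] := cK _ FF (ex_intro2 _ _ b Db (fun y Sy => proj1 Sy)).
have phip a : D a -> (phi p <= a%:E)%E.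
  move=> Da; apply: (clphi a) => B pB.
  have [z [[_ za] Bz]] := clp (S a) B (ex_intro2 _ _ a Da (@subset_refl _ _)) pB.
  by exists z.
exists p => // y Ky; apply: le_trans (mlb _ Ky).
move: phip; rewrite /D /=; case: (m) => [r| |] phip.
- by apply/lee_addgt0Pr => e e0; apply: phip; rewrite lte_fin ltrDl.
- exact: leey.
- move: phip; case: (phi p) => [s phis|phis|_] //.
    by have := phis (s - 1) (ltNyr _); rewrite lee_fin lerBrDl gerDr ler10.
  by have := phis 0 (ltNyr _).
Qed.

Lemma epigraph_convex {R : realType} {d : nat} (h : 'rV[R]_d -> \bar R)
    (u w : 'rV[R]_d) (a b t : R) :
  closed_proper_convex h -> 0 <= t -> t <= 1 ->
  (h u <= a%:E)%E -> (h w <= b%:E)%E ->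
  (h (t *: u + (1 - t) *: w)%R <= (t * a + (1 - t) * b)%:E)%E.
Proof.
move=> [_ _ cvx] t0 t1 hu hw.
have := cvx (u, a) (w, b) (Itv01 t0 t1) (mem_set hu) (mem_set hw).
by rewrite inE.
Qed.

(** The compact balls below are sup-norm balls, while the prox term is Euclidean; a single squared
    coordinate is at most the sum. *)
Lemma sqr_norm_le_dot {R : realType} {d : nat} (w : 'rV[R]_d) :
  `|w| ^+ 2 <= dot w w.
Proof.
rewrite -sqr_enorm ler_pXn2r ?nnegrE ?normr_ge0 ?sqrtr_ge0//.
rewrite [leLHS]mx_normrE; apply: bigmax_le => [|ij _]; first exact: sqrtr_ge0.
rewrite -(@ler_pXn2r _ 2)// ?nnegrE ?sqrtr_ge0// sqr_enorm real_normK ?num_real//.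
rewrite (ord1 ij.1) /dot (bigD1 ij.2)//= -expr2 lerDl.
by apply: sumr_ge0 => i _; rewrite -expr2 sqr_ge0.
Qed.

Lemma continuous_dot_sub {R : realType} {d : nat} (v : 'rV[R]_d) :
  continuous (fun y : 'rV[R]_d => dot (v - y) (v - y)).
Proof.
have coord (i : 'I_d) : continuous (fun y : 'rV[R]_d => (v - y) 0 i : R^o).
  have -> : (fun y : 'rV[R]_d => (v - y) 0 i : R^o) =
            (fun y => v 0 i - y 0 i) by apply/funext => y; rewrite !mxE.
  move=> y; apply: continuousB; [exact: cst_continuous|exact: coord_continuous].
apply: continuous_big => [|i _ y]; first exact: add_continuous.
by apply: continuousM; exact: coord.
Qed.

Lemma compact_ball_le {R : realType} {d : nat} (a : 'rV[R]_d) (r : R) :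
  compact [set y : 'rV[R]_d | `|y - a| <= r].
Proof.
apply: bounded_closed_compact.
  exists (`|a| + r); split; first exact: num_real.
  move=> M rM y /= ya; rewrite (le_trans _ (ltW rM))//.
  by rewrite -[y](subrK a) (le_trans (ler_normD _ _))// addrC lerD.
have -> : [set y : 'rV[R]_d | `|y - a| <= r] =
    (fun y => `|y - a| : R^o) @^-1` [set s | s <= r] by [].
apply: preimage_closed; last exact: closed_le.
move=> y _; apply: continuous_comp; last exact: norm_continuous.
by apply: continuousB; [exact: cvg_id|exact: cst_continuous].
Qed.

(** The level [q] may vary with [y], so that it can absorb the quadratic term of the prox
    objective. *)
Lemma closed_sublevel {R : realType} {d : nat} (h : 'rV[R]_d -> \bar R)
    (q : 'rV[R]_d -> R) :
  closed (epigraph h) -> continuous q -> closed [set y | (h y <= (q y)%:E)%E].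
Proof.
move=> clh cq.
have -> : [set y | (h y <= (q y)%:E)%E] =
    (fun y => (y, q y)) @^-1` (epigraph h : set ('rV[R]_d * R^o)) by [].
apply: preimage_closed => // y _.
exact: (cvg_pair (F := nbhs y) (G := nbhs y) (H := nbhs (q y : R^o))
  cvg_id (cq y)).
Qed.

(** * Proximal points: optimality condition, uniqueness, existence *)

Section prox_theory.
Context {R : realType} {d : nat} (h : 'rV[R]_d -> \bar R).
Hypothesis hh : closed_proper_convex h.
Variables (gamma : R) (v : 'rV[R]_d).
Hypothesis gamma_gt0 : 0 < gamma.

Let obj (y : 'rV[R]_d) : \bar R :=
  (gamma%:E * h y + (2^-1 * enorm (v - y) ^+ 2)%:E)%E.

Let obj_le (y : 'rV[R]_d) (a : R) :
  (obj y <= a%:E)%E =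
  (h y <= ((a - 2^-1 * dot (v - y) (v - y)) / gamma)%:E)%E.
Proof.
rewrite /obj sqr_enorm; have [_ [hNy _] _] := hh.
move: (hNy y); case: (h y) => [r| |] //= _.
  by rewrite -EFinM -EFinD !lee_fin ler_pdivlMr// mulrC lerBrDr.
by rewrite gt0_muley ?lte_fin// addye// !leye_eq.
Qed.

Lemma prox_fin_num (p : 'rV[R]_d) : prox_set gamma h v p -> h p \is a fin_num.
Proof.
have [_ [hNy [z hz]] _] := hh; move=> [_ /(_ z I)].
rewrite -/(obj p) -/(obj z).
have [r hzr] : exists r, h z = r%:E.
  by move: hz (hNy z); case: (h z) => [r| |] // _ _; exists r.
rewrite {2}/obj hzr -EFinM -EFinD obj_le fin_numE hNy /= => hp.
by apply: contraTN hp => /eqP ->; rewrite leye_eq.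
Qed.

(** First-order optimality, [(v - p) / gamma] being a subgradient of [h] at [p]: compare [p] with
    [p + t (u - p)] for small [t]. *)
Lemma prox_subgradient (p u : 'rV[R]_d) (a b : R) :
  prox_set gamma h v p -> h p = a%:E -> (h u <= b%:E)%E ->
  dot (v - p) (u - p) <= gamma * (b - a).
Proof.
move=> [_ pmin] hp hu.
set D := dot (u - p) (u - p); set E := dot (v - p) (u - p).
have D0 : 0 <= D := dotxx_ge0 _.
have step (t : R) : 0 < t -> t <= 1 -> E <= gamma * (b - a) + t / 2 * D.
  move=> t0 t1.
  have := epigraph_convex h u p b a t hh (ltW t0) t1 hu.
  rewrite hp => /(_ (lexx _)); set w := t *: u + (1 - t) *: p => hw.
  have := pmin w I; rewrite -/(obj w) leNgt => /negP pw.
  rewrite leNgt; apply/negP => lt_E; apply: pw.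
  have vw : v - w = v - p - t *: (u - p).
    by apply/rowP => i; rewrite !mxE; ring.
  apply: (@le_lt_trans _ _ (gamma * (t * b + (1 - t) * a)
      + 2^-1 * dot (v - w) (v - w))%:E).
    by rewrite obj_le addrK mulrAC divff ?gt_eqF// mul1r.
  rewrite hp sqr_enorm -EFinM -EFinD lte_fin vw.
  have : t * (gamma * (b - a) + t / 2 * D) < t * E by rewrite ltr_pM2l.
  rewrite /E /D.
  move: (u - p) (v - p) => e g; rewrite !dotE (dotC e g); lra.
rewrite leNgt; apply/negP => lt_E.
pose e := E - gamma * (b - a).
have e0 : 0 < e by rewrite subr_gt0.
have eD : 0 < e + D by rewrite ltr_wpDr.
(* For this [t], [t * D = e - t * e < e], so [step] would give [e < e / 2]. *)
have t0 : 0 < e / (e + D) by rewrite divr_gt0.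
have t1 : e / (e + D) <= 1 by rewrite ler_pdivrMr// mul1r lerDl.
have := step _ t0 t1.
have : e / (e + D) * (e + D) = e by rewrite divfK ?gt_eqF.
move: (e / (e + D)) t0 t1 => t t0 t1 te.
have -> : E = e + gamma * (b - a) by rewrite /e subrK.
nra.
Qed.

(** The subgradient inequalities at [p] and [p'] add up to [|p' - p|^2 <= 0]. *)
Lemma prox_set_uniq (p p' : 'rV[R]_d) :
  prox_set gamma h v p -> prox_set gamma h v p' -> p = p'.
Proof.
move=> hp hp'; have fp := prox_fin_num _ hp; have fp' := prox_fin_num _ hp'.
have le_refl (q : 'rV[R]_d) : h q \is a fin_num -> (h q <= (fine (h q))%:E)%E.
  by move=> fq; rewrite fineK.
have := prox_subgradient _ _ _ _ hp (esym (fineK fp)) (le_refl _ fp').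
have := prox_subgradient _ _ _ _ hp' (esym (fineK fp')) (le_refl _ fp).
have -> : p - p' = - (p' - p) by rewrite opprB.
have -> : v - p' = v - p - (p' - p) by apply/rowP => i; rewrite !mxE; ring.
move: (fine _) (fine _) (v - p) => a b w.
rewrite !dotE => le1 le2; apply/esym/eqP; rewrite -subr_eq0; apply/eqP.
apply: dotxx_eq0; rewrite !dotE; lra.
Qed.

(** A minimizer over a large ball around a point [z] of the domain is global: outside the ball the
    objective is at least its value at [z]. *)
Lemma prox_set_nonempty : prox_set gamma h v !=set0.
Proof.
have [clh [hNy [z hz]] _] := hh.
have [r0 hzr] : exists r, h z = r%:E.
  by move: hz (hNy z); case: (h z) => [r| |] // _ _; exists r.
have ball_ne r : 0 <= r -> [set y : 'rV[R]_d | `|y - z| <= r] !=set0.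
  by move=> r_ge0; exists z => /=; rewrite subrr normr0.
have [m m_le_h] : exists m : R,
    forall y, `|y - z| <= 1 -> (m%:E <= h y)%E.
  have cl_h (a : R) : closed [set y | (h y <= a%:E)%E].
    by apply: (@closed_sublevel _ _ h (cst a) clh) => y; exact: cst_continuous.
  have [p _ p_min] :=
    compact_lsc_min _ _ (compact_ball_le z 1) (ball_ne _ ler01) cl_h.
  move: p_min (hNy p); case: (h p) => [m| |] // p_min _; first by exists m.
  have := p_min z; rewrite /= subrr normr0 ler01 hzr => /(_ isT).
  by rewrite leye_eq.
(* Convexity along the segment from [z] to [y], through the unit sphere. *)
have growth (y : 'rV[R]_d) (b : R) : 1 < `|y - z| -> (h y <= b%:E)%E ->
    r0 - `|y - z| * (r0 - m) <= b.
  move=> yz1 hyb; set t := `|y - z| in yz1 *.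
  have t0 : 0 < t by rewrite (lt_trans ltr01).
  have ti0 : 0 < t^-1 by rewrite invr_gt0.
  have ti1 : t^-1 <= 1 by rewrite invf_le1// ltW.
  have := epigraph_convex h y z b r0 t^-1 hh (ltW ti0) ti1 hyb.
  rewrite hzr => /(_ (lexx _)); set w := _ *: y + _ => hw.
  have wz : `|w - z| <= 1.
    have -> : w - z = t^-1 *: (y - z).
      by apply/rowP => i; rewrite !mxE; ring.
    by rewrite normrZ gtr0_norm// -/t mulVf// gt_eqF.
  have := le_trans (m_le_h w wz) hw; rewrite lee_fin.
  rewrite -(ler_pM2l t0) mulrDr !mulrA mulrBr mulfV ?gt_eqF// mulr1.
  lra.
pose c := gamma * (r0 - m); pose D := dot (v - z) (v - z).
have c0 : 0 <= c.
  apply: mulr_ge0; first exact: ltW.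
  rewrite subr_ge0 -lee_fin -hzr; apply: m_le_h.
  by rewrite subrr normr0.
have D0 : 0 <= D := dotxx_ge0 _.
(* At distance [t > T] the objective exceeds its value at [z] by at least [t^2 / 4 - c t - D], which
   is nonnegative since [t / 4 >= c + D] and [t >= 1]. *)
pose T := 4 * c + 4 * D + 1.
have T1 : 1 <= T by rewrite /T; lra.
have T0 : 0 <= T := le_trans ler01 T1.
have cl_obj (a : R) : closed [set y | (obj y <= a%:E)%E].
  under eq_set do rewrite obj_le.
  apply: (@closed_sublevel _ _ h
    (fun y => (a - 2^-1 * dot (v - y) (v - y)) / gamma) clh).
  have cont_aff : continuous (fun t : R => (a - 2^-1 * t) / gamma).
    move=> t; apply: cvgMr_tmp; apply: cvgB; first exact: cvg_cst.
    by apply: cvgMl_tmp; exact: cvg_id.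
  move=> y; exact: (continuous_comp (continuous_dot_sub v y) (cont_aff _)).
have [p pT p_min] :=
  compact_lsc_min _ _ (compact_ball_le z T) (ball_ne _ T0) cl_obj.
exists p; split => // y _; rewrite -/(obj p) -/(obj y).
have [yT|Ty] := leP `|y - z| T; first exact: p_min.
have pz : (obj p <= obj z)%E by apply: p_min; rewrite /= subrr normr0.
apply: (le_trans pz).
have := growth y; rewrite {2}/obj.
move: (hNy y); case: (h y) => [b| |] // _; last first.
  by rewrite gt0_muley ?lte_fin// addye// leey.
move=> /(_ b (le_lt_trans T1 Ty) (lexx _)) le_b.
rewrite /obj hzr -!EFinM -!EFinD lee_fin !sqr_enorm.
have := sqr_norm_le_dot (y - z).
(* This square yields [|v - y|^2 / 2 >= |y - z|^2 / 4 - D / 2]. *)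
have := dotxx_ge0 (2^-1 *: (y - z) - (v - z)).
have -> : v - y = v - z - (y - z) by apply/rowP => i; rewrite !mxE; ring.
move: c0 D0 le_b Ty; rewrite /T /D /c.
move: (v - z) (dotxx_ge0 (v - z)) => g _.
move: (y - z) => e; move: `|e| => t c0 D0 le_b Ty.
rewrite !dotE (dotC e g) => sq te.
have t_ge1 : 1 <= t by rewrite (le_trans _ (ltW Ty))//; lra.
have : gamma * (r0 - t * (r0 - m)) <= gamma * b by rewrite ler_pM2l.
have : 0 <= t * (t / 4 - gamma * (r0 - m) - dot g g).
  by apply: mulr_ge0; lra.
have : 0 <= dot g g * (t - 1) by apply: mulr_ge0; lra.
lra.
Qed.

Lemma prox_definedP : prox_defined gamma h v.
Proof.
have [p hp] := prox_set_nonempty; exists p.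
apply/seteqP; split => [q hq|q ->] //=; exact: prox_set_uniq.
Qed.

Lemma prox_in : prox_set gamma h v (prox gamma h v).
Proof.
by have [p hp] := prox_set_nonempty; rewrite /prox; case: xgetP => [//|/(_ p)].
Qed.

End prox_theory.

(** * The contraction for one step of length [2 / (L + mu)] *)

(* [g], [q], [g'] stand for the gradients at [x], [p], [y]; [v / gamma] is the
   subgradient of [h] at [p]. *)
Lemma rate_certificate {R : realType} {d : nat} (mu L : R)
    (x p y g q g' : 'rV[R]_d)
    (gamma := 2 / (L + mu)) (rho := (L - mu) / (L + mu))
    (r1 := g - q - mu *: (x - p)) (r2 := g' - g - mu *: (y - x))
    (r3 := g' - q - mu *: (y - p)) (v := x - gamma *: g - p)
    (c := (2 * (L - mu))^-1)
    (a := rho *: (x - y) - (p - y) + L^-1 *: (r2 - r3)) (b := rho *: r2 + r3) :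
  0 < mu -> mu < L ->
  rho * (dot q (x - p) + mu / 2 * dot (x - p) (x - p) + c * dot r1 r1)
  + (1 - rho) * rho
    * (dot g (y - x) + mu / 2 * dot (y - x) (y - x) + c * dot r2 r2)
  + (1 - rho) * (dot q (y - p) + mu / 2 * dot (y - p) (y - p) + c * dot r3 r3)
  + gamma^-1 * (rho ^+ 2 * dot v (x - p) + (1 - rho ^+ 2) * dot v (y - p))
  = L / 2 * dot a a + mu / (2 * L * (L - mu)) * dot b b.
Proof.
move=> mu_gt0 muL.
have L0 : L != 0 by rewrite gt_eqF// (lt_trans mu_gt0).
have Lp : L + mu != 0 by rewrite gt_eqF// addr_gt0// (lt_trans mu_gt0).
have Lm : L - mu != 0 by rewrite gt_eqF// subr_gt0.
(* Both sides are sums over coordinates, and the identity already holds in each coordinate. *)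
rewrite /dot !mulr_sumr -!big_split /= !mulr_sumr -!big_split /=.
apply: eq_bigr => i _.
rewrite /a /b /v /r1 /r2 /r3 /c /rho /gamma !mxE.
by field; rewrite ?L0 ?Lp ?Lm ?mulf_neq0.
Qed.

(** The inequality towards [x] has weight [rho^2], which vanishes for [mu = L]; its guard [mu < L]
    lets [hx] be arbitrary in that case. *)
Lemma prox_grad_step_decrease {R : realType} {d : nat} (mu L : R)
    (f : 'rV[R]_d -> R) (x p y : 'rV[R]_d) (hx hp hy : R)
    (gamma := 2 / (L + mu)) (rho := (L - mu) / (L + mu))
    (v := grad_step f x gamma) :
  0 < mu -> mu <= L -> smooth_strongly_convex mu L f ->
  dot (v - p) (y - p) <= gamma * (hy - hp) ->
  (mu < L -> dot (v - p) (x - p) <= gamma * (hx - hp)) ->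
  f p + hp - (f y + hy) <= rho ^+ 2 * (f x + hx - (f y + hy)).
Proof.
move=> mu0; rewrite le_eqVlt => /predU1P[muL|muL] hf sub_y sub_x.
(* For [mu = L] the upper model at [p] and the lower model at [y] have equal curvature; with the
   prox inequality, [- L / 2 |y - p|^2] remains. *)
- have [df sf cf] := hf.
  have L0 : 0 < L by rewrite -muL.
  have := strongly_convex_lower mu f x (y - x) (df x) cf.
  have := L_smooth_upper L f x (p - x) L0 df sf.
  move: sub_y; rewrite /v /grad_step /rho /gamma muL subrr mul0r expr0n mul0r.
  have -> : 2 / (L + L) = L^-1 by field; rewrite !gt_eqF ?addr_gt0.
  rewrite (addrC x (p - x)) (addrC x (y - x)) !subrK.
  have -> : y - p = (y - x) - (p - x) by apply/rowP => i; rewrite !mxE; ring.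
  have -> : x - L^-1 *: grad f x - p = - (p - x) - L^-1 *: grad f x.
    by apply/rowP => i; rewrite !mxE; ring.
  rewrite -(ler_pM2l L0) mulrA divff ?gt_eqF// mul1r.
  move: (grad f x) (y - x) (p - x) => g a b sub_y upper lower.
  have E : L * dot (- b - L^-1 *: g) (a - b) =
           L * (dot b b - dot a b) - dot g a + dot g b.
    by rewrite !dotE (dotC b a); field; rewrite gt_eqF.
  move: sub_y; rewrite E; have := dotxx_ge0 (a - b).
  rewrite -(pmulr_rge0 _ L0) !dotE (dotC b a); lra.
have lp : 0 < L + mu by rewrite addr_gt0// (lt_trans mu0).
have lm : 0 < L - mu by rewrite subr_gt0.
have gamma0 : 0 < gamma by rewrite divr_gt0.
have rho0 : 0 <= rho by rewrite divr_ge0 ?ltW.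
have rho1 : 0 <= 1 - rho.
  by rewrite subr_ge0 ler_pdivrMr// mul1r; lra.
have cert :=
  rate_certificate mu L x p y (grad f x) (grad f p) (grad f y) mu0 muL.
have I1 := smooth_strongly_convex_interpolation mu L f x p mu0 muL hf.
have I2 := smooth_strongly_convex_interpolation mu L f y x mu0 muL hf.
have I3 := smooth_strongly_convex_interpolation mu L f y p mu0 muL hf.
have {}sub_x : gamma^-1 * dot (v - p) (x - p) <= hx - hp.
  by rewrite ler_pdivrMl// sub_x.
have {}sub_y : gamma^-1 * dot (v - p) (y - p) <= hy - hp.
  by rewrite ler_pdivrMl.
move: cert; rewrite -/gamma -/rho -/(grad_step f x gamma) -/v.
set rhs := (X in _ = X) => cert.
have rhs0 : 0 <= rhs.
  rewrite addr_ge0// mulr_ge0 ?dotxx_ge0// divr_ge0// ?mulr_ge0 ?ltW//.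
    exact: lt_trans mu0 muL.
  by rewrite (lt_trans mu0 muL).
move: cert rhs0 => <-.
(* With these weights the values of [f] combine to [f p - rho^2 f x - (1 - rho^2) f y], and those of
   [h] likewise. *)
have := ler_wpM2l rho0 I1.
have := ler_wpM2l (mulr_ge0 rho1 rho0) I2.
have := ler_wpM2l rho1 I3.
have := ler_wpM2l (sqr_ge0 rho) sub_x.
have rho21 : 0 <= 1 - rho ^+ 2.
  have -> : 1 - rho ^+ 2 = (1 - rho) * (1 + rho) by ring.
  by rewrite mulr_ge0// addr_ge0.
have := ler_wpM2l rho21 sub_y.
lra.
Qed.

(** * From the fixed step to exact line search, with infinite values *)

Theorem corollary2p1 (R : realType) (d : nat) (hd : (1 <= d)%N)
  (mu L : R) (hmu : 0 < mu) (hmuL : mu <= L)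
  (f : 'rV[R]_d -> R) (hf : smooth_strongly_convex mu L f)
  (h : 'rV[R]_d -> \bar R) (hh : closed_proper_convex h)
  (x0 : 'rV[R]_d) (gamma : nat -> R) (x : nat -> 'rV[R]_d)
  (hx : pgm_exact_line_search f h x0 gamma x) :
  let F := objective f h in
  let Fstar := min_value F in
  forall k : nat,
    (F (x k.+1) - Fstar <=
     (((L - mu) / (L + mu)) ^+ 2)%:E * (F (x k) - Fstar))%E.
Proof.
move=> F Fstar k.
have [_ [hNy _] _] := hh.
have L0 : 0 < L := lt_le_trans hmu hmuL.
have Lp : 0 < L + mu by rewrite addr_gt0.
pose g := 2 / (L + mu).
have g0 : 0 < g by rewrite divr_gt0.
pose v := grad_step f (x k) g; pose p := prox g h v.
have p_prox : prox_set g h v p := prox_in h hh g v g0.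
have hp := fineK (prox_fin_num h hh g v g0 p p_prox).
have step_le : (F (x k.+1) <= F p)%E.
  have [_ /(_ k)[[_ gk_min] ->]] := hx.
  exact: (gk_min g (prox_definedP h hh g v g0)).
have sub u b : (h u <= b%:E)%E ->
    dot (v - p) (u - p) <= g * (b - fine (h p)).
  exact: (prox_subgradient h hh g v g0 p u _ b p_prox (esym hp)).
rewrite /Fstar /min_value; set y := xget 0 _.
(* The junk point [y] of [min_value] may have [F y = +oo]; then the left-hand
   side is [-oo]. *)
have [hy|hy] := eqVneq (h y) +oo%E.
  have -> : F y = +oo%E by rewrite /F /objective hy addey.
  by rewrite [(- +oo)%E]/= addeNy leNye.
have [b hyb] : exists b, h y = b%:E.
  by move: hy (hNy y); case: (h y) => [b| |] // _ _; exists b.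
have sub_y : dot (v - p) (y - p) <= g * (b - fine (h p)).
  by apply: sub; rewrite hyb.
apply: (le_trans (leeB step_le (lexx (F y)))).
(* [c] stands in for [h (x k)]; for [mu = L] it can be any real, which covers [h (x k) = +oo]. *)
have decrease c : (mu < L -> (h (x k) <= c%:E)%E) ->
    (F p - F y <= (((L - mu) / (L + mu)) ^+ 2
                   * (f (x k) + c - (f y + b)))%:E)%E.
  move=> hxc; rewrite /F /objective -hp hyb -!EFinD lee_fin.
  apply: (prox_grad_step_decrease mu L f (x k) p y c _ b hmu hmuL hf sub_y).
  by move=> /hxc; exact: sub.
case hxk : (h (x k)) (hNy (x k)) => [c| |] // _.
- have := decrease c; rewrite hxk lexx => /(_ (fun _ => isT)).
  by rewrite /F /objective hxk hyb -!EFinD -EFinM.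
- have [muL|muL] := ltP mu L.
    (* Here [rho^2 > 0] and [F (x k) = +oo], so the right-hand side is [+oo]. *)
    rewrite [X in (_ <= _ * (X - _))%E]/F [X in (_ <= _ * (_ - X))%E]/F.
    rewrite /objective hxk hyb addey// -EFinD addye// gt0_muley ?leey//.
    by rewrite lte_fin exprn_gt0// divr_gt0// subr_gt0.
  (* Here [rho = 0], and [0 * +oo = 0] on the right-hand side. *)
  have := decrease 0.
  rewrite (le_gtF muL) => /(_ (fun lt_mu_L => False_ind _ (notF lt_mu_L))).
  have -> : L - mu = 0 by apply/eqP; rewrite subr_eq0 eq_le muL hmuL.
  by rewrite mul0r expr0n mul0r mul0e.
Qed.
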